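(* Let $A$ be a commutative unital locally convex algebra, $G$ a compact abelian group and $(A,G,\alpha)$ a dynamical system. If each isotypic component $A_{\varphi}$, $\varphi\in\widehat{G}$, contains an invertible element (of $A$), then the dynamical system $(A,G,\alpha)$ is free.
   Context: Algebras are complex. A dynamical system $(A,G,\alpha)$ consists of a unital locally convex algebra $A$, a topological group $G$ and a group homomorphism $\alpha:G\to\mathrm{Aut}(A)$ such that the action map $G\times A\to A$ is continuous. $\Gamma_A:=\mathrm{Hom}_{\mathrm{alg}}(A,\mathbb{C})\setminus\{0\}$ is the spectrum of $A$. $\widehat{G}$ is the (continuous) character group of $G$, and for $\varphi\in\widehat{G}$ the isotypic component is $A_{\varphi}:=\{a\in A:\ \alpha(g)(a)=\varphi(g)\cdot a\ \text{for all } g\in G\}$. A family $(\pi_j,V_j)_{j\in J}$ of (continuous) representations of $G$ is point separating if for each $g\neq 1_G$ there is $j\in J$ with $\pi_j(g)\neq\mathrm{id}_{V_j}$. For a representation $(\pi,V)$ of $G$ put $$\Gamma_A V:=(A\otimes V)^G=\{s\in A\otimes V:\ (\alpha(g)\otimes\pi(g))(s)=s\ \text{for all } g\in G\}.$$ A dynamical system $(A,G,\alpha)$ with $A$ commutative is called free if there exists a point separating family $(\pi_j,V_j)_{j\in J}$ of representations of $G$ such that for all $j\in J$ and all $\chi\in\Gamma_A$ the map $\Gamma_A V_j\to V_j$, $a\otimes v\mapsto\chi(a)\cdot v$ (the restriction of $\chi\otimes\mathrm{id}_{V_j}$) is surjective. *)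

(* Defs.v *)
From HB Require Import structures.
From mathcomp Require Import all_boot all_order all_algebra generic_quotient.
From mathcomp Require Import complex.
From mathcomp Require Import boolp classical_sets functions reals.
From mathcomp Require Import topology normedtype.
Import GRing.Theory.
Import numFieldNormedType.Exports.

Set Implicit Arguments.
Unset Strict Implicit.
Unset Printing Implicit Defensive.

Local Open Scope classical_set_scope.
Local Open Scope ring_scope.
Local Open Scope quotient_scope.

Section TensorType.
Context (K : comNzRingType) (U V : lmodType K).
Implicit Types (u : U) (v : V) (s t : seq (U * V)).

(* A sequence of pairs stands for the formal sum of the corresponding pure
   tensors; [tens_eq] is the congruence generated by bilinearity.  Sequences
   form a free monoid, not a free group: [tens_eq0] is what makes [(- u, v)] an
   inverse of [(u, v)]. *)
Inductive tens_eq : seq (U * V) -> seq (U * V) -> Prop :=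
| tens_eq_refl s : tens_eq s s
| tens_eq_sym s t : tens_eq s t -> tens_eq t s
| tens_eq_trans s t r : tens_eq s t -> tens_eq t r -> tens_eq s r
| tens_eq_cat s s' t t' :
    tens_eq s s' -> tens_eq t t' -> tens_eq (s ++ t) (s' ++ t')
| tens_eqC s t : tens_eq (s ++ t) (t ++ s)
| tens_eq0 v : tens_eq [:: (0, v)] [::]
| tens_eqDl u u' v : tens_eq [:: (u + u', v)] [:: (u, v); (u', v)]
| tens_eqDr u v v' : tens_eq [:: (u, v + v')] [:: (u, v); (u, v')]
| tens_eqZ (c : K) u v : tens_eq [:: (c *: u, v)] [:: (u, c *: v)].

Let tens_eqb s t := `[< tens_eq s t >].

Let tens_eqb_equiv : equiv_class_of tens_eqb.
Proof.
split=> [s|s t|t s r].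
- exact/asboolP/tens_eq_refl.
- by apply/asboolP/asboolP; exact: tens_eq_sym.
- by move=> /asboolP st /asboolP tr; exact/asboolP/(tens_eq_trans st tr).
Qed.

Canonical tens_equiv := EquivRelPack tens_eqb_equiv.

Definition tensor : Type := {eq_quot tens_equiv}.

HB.instance Definition _ := Choice.on tensor.
HB.instance Definition _ := EqQuotient.on tensor.

Let mk s : tensor := \pi_tensor s.

Let mkP s t : tens_eq s t -> mk s = mk t.
Proof. by move=> st; apply/eqmodP; exact/asboolP. Qed.

Let mkE s t : mk s = mk t -> tens_eq s t.
Proof. by move=> /eqmodP/asboolP. Qed.

Let tensW (P : tensor -> Prop) : (forall s, P (mk s)) -> forall x, P x.
Proof. by move=> Pmk x; rewrite -[x]reprK; exact: Pmk. Qed.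

Let reprP s : tens_eq (repr (mk s)) s.
Proof. by apply: mkE; rewrite /mk reprK. Qed.

Let scal (c : K) s := [seq (c *: p.1, p.2) | p <- s].

Let scalP c s t : tens_eq s t -> tens_eq (scal c s) (scal c t).
Proof.
elim=> {s t} [s|s t _ h|s t r _ h _ h'|s s' t t' _ h _ h'|s t|v|u u' v|u v v'
  |d u v]; rewrite /scal ?map_cat.
- exact: tens_eq_refl.
- exact: tens_eq_sym.
- exact: tens_eq_trans h h'.
- exact: tens_eq_cat.
- exact: tens_eqC.
- by rewrite /= scaler0; exact: tens_eq0.
- by rewrite /= scalerDr; exact: tens_eqDl.
- by rewrite /=; exact: tens_eqDr.
- by rewrite /= scalerA mulrC -scalerA; exact: tens_eqZ.
Qed.

Let add (x y : tensor) : tensor := mk (repr x ++ repr y).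
Let scale (c : K) (x : tensor) : tensor := mk (scal c (repr x)).
Let opp (x : tensor) : tensor := scale (-1) x.

Let addE s t : add (mk s) (mk t) = mk (s ++ t).
Proof. by apply: mkP; apply: tens_eq_cat; exact: reprP. Qed.

Let scaleE c s : scale c (mk s) = mk (scal c s).
Proof. by apply: mkP; apply: scalP; exact: reprP. Qed.

Let addA : associative add.
Proof.
by elim/tensW=> s; elim/tensW=> t; elim/tensW=> r; rewrite !addE catA.
Qed.

Let addC : commutative add.
Proof.
by elim/tensW=> s; elim/tensW=> t; rewrite !addE; apply: mkP; exact: tens_eqC.
Qed.

Let add0 : left_id (mk [::]) add.
Proof. by elim/tensW=> s; rewrite addE. Qed.

Let scaleDl_ x c d : scale (c + d) x = add (scale c x) (scale d x).
Proof.
elim/tensW: x => s; rewrite !scaleE addE.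
elim: s => [//|[u v] s IHs] /=.
apply: mkP; rewrite -cat1s.
have h1 : tens_eq [:: ((c + d) *: u, v)] [:: (c *: u, v); (d *: u, v)].
  by rewrite scalerDl; exact: tens_eqDl.
apply: tens_eq_trans (tens_eq_cat h1 (mkE IHs)) _ => /=.
rewrite -cat1s -[X in tens_eq _ X]cat1s.
apply: tens_eq_cat; first exact: tens_eq_refl.
rewrite -cat1s catA -[X in tens_eq _ (_ ++ X)]cat1s catA.
apply: tens_eq_cat; last exact: tens_eq_refl.
exact: tens_eqC.
Qed.

Let scale1_ : left_id 1 scale.
Proof.
elim/tensW=> s; rewrite scaleE /scal; congr mk.
by rewrite -[RHS]map_id; apply: eq_map => -[u v]; rewrite scale1r.
Qed.

Let scale0_ x : scale 0 x = mk [::].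
Proof.
elim/tensW: x => s; rewrite scaleE; apply: mkP.
elim: s => [|[u v] s IHs] /=; first exact: tens_eq_refl.
rewrite scale0r -cat1s -[X in tens_eq _ X]cat0s.
by apply: tens_eq_cat => //; exact: tens_eq0.
Qed.

Let addN : left_inverse (mk [::]) opp add.
Proof.
move=> x; rewrite /opp -[X in add _ X]scale1_ -scaleDl_ addNr.
exact: scale0_.
Qed.

HB.instance Definition _ := GRing.isZmodule.Build tensor addA addC add0 addN.

Let scaleA_ c d x : scale c (scale d x) = scale (c * d) x.
Proof.
elim/tensW: x => s; rewrite !scaleE /scal -map_comp; congr mk.
by apply: eq_map => -[u v] /=; rewrite scalerA.
Qed.

Let scaleDr_ : right_distributive scale +%R.
Proof.
move=> c; elim/tensW=> s; elim/tensW=> t.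
rewrite [mk s + mk t]addE !scaleE.
by rewrite [RHS]addE /scal map_cat.
Qed.

HB.instance Definition _ := GRing.Zmodule_isLmodule.Build K tensor
  scaleA_ scale1_ scaleDr_ scaleDl_.

Definition tens (u : U) (v : V) : tensor := mk [:: (u, v)].

Lemma tensDl u u' v : tens (u + u') v = tens u v + tens u' v.
Proof. by rewrite [RHS]addE; apply: mkP; exact: tens_eqDl. Qed.

Lemma tensDr u v v' : tens u (v + v') = tens u v + tens u v'.
Proof. by rewrite [RHS]addE; apply: mkP; exact: tens_eqDr. Qed.

Lemma tensZl c u v : tens (c *: u) v = c *: tens u v.
Proof. by rewrite [RHS]scaleE. Qed.

Lemma tensZr c u v : tens u (c *: v) = c *: tens u v.
Proof. by rewrite -tensZl; apply: mkP; apply/tens_eq_sym/tens_eqZ. Qed.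

Lemma tens_sum (x : tensor) : x = \sum_(p <- repr x) tens p.1 p.2.
Proof.
rewrite -[LHS]reprK; elim: (repr x) => [|[u v] s IHs]; first by rewrite big_nil.
by rewrite big_cons -IHs [RHS]addE.
Qed.

Section Lift.
Context (W : lmodType K) (f : U -> V -> W).

(* The linear map induced by a bilinear map [f]; junk if [f] is not bilinear,
   since it then depends on the chosen representative. *)
Definition tens_lift (x : tensor) : W := \sum_(p <- repr x) f p.1 p.2.

Hypotheses (fDl : forall u u' v, f (u + u') v = f u v + f u' v)
  (fDr : forall u v v', f u (v + v') = f u v + f u v')
  (fZl : forall c u v, f (c *: u) v = c *: f u v)
  (fZr : forall c u v, f u (c *: v) = c *: f u v).

Let lift_eq s t : tens_eq s t ->
  \sum_(p <- s) f p.1 p.2 = \sum_(p <- t) f p.1 p.2.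
Proof.
elim=> {s t} [s|s t _ h|s t r _ h _ h'|s s' t t' _ h _ h'|s t|v|u u' v|u v v'
  |d u v]; rewrite ?big_cat ?big_cons ?big_nil //=.
- by rewrite h.
- by rewrite h h'.
- by rewrite addrC.
- by rewrite -[X in f X _](scale0r 0) fZl scale0r addr0.
- by rewrite fDl !addr0.
- by rewrite fDr !addr0.
- by rewrite fZl fZr.
Qed.

Let lift_mk s : tens_lift (mk s) = \sum_(p <- s) f p.1 p.2.
Proof. exact/lift_eq/reprP. Qed.

Lemma tens_liftE u v : tens_lift (tens u v) = f u v.
Proof. by rewrite lift_mk big_seq1. Qed.

Lemma tens_lift_linear c x y :
  tens_lift (c *: x + y) = c *: tens_lift x + tens_lift y.
Proof.
elim/tensW: x => s; elim/tensW: y => t.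
rewrite [c *: mk s]scaleE [_ + mk t]addE !lift_mk big_cat /= big_map.
by congr (_ + _); rewrite scaler_sumr; apply: eq_bigr => p _; rewrite fZl.
Qed.

End Lift.

End TensorType.

Definition tens_map (K : comNzRingType) (U V U' V' : lmodType K)
    (f : {linear U -> U'}) (g : {linear V -> V'}) : tensor U V -> tensor U' V' :=
  tens_lift (fun u v => tens (f u) (g v)).

Lemma tens_mapE (K : comNzRingType) (U V U' V' : lmodType K)
    (f : {linear U -> U'}) (g : {linear V -> V'}) u v :
  tens_map f g (tens u v) = tens (f u) (g v).
Proof.
apply: tens_liftE => [u1 u2 w|w v1 v2|c w1 w2|c w1 w2].
- by rewrite linearD tensDl.
- by rewrite linearD tensDr.
- by rewrite linearZ tensZl.
- by rewrite linearZ tensZr.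
Qed.

(* [chi (x) id] followed by the identification of [K (x) V] with [V]. *)
Definition tens_eval (K : comNzRingType) (U V : lmodType K)
    (chi : {linear U -> K^o}) : tensor U V -> V :=
  tens_lift (fun u v => (chi u : K) *: v).

Lemma tens_evalE (K : comNzRingType) (U V : lmodType K)
    (chi : {linear U -> K^o}) u (v : V) :
  tens_eval chi (tens u v) = (chi u : K) *: v.
Proof.
apply: tens_liftE => [u1 u2 w|w v1 v2|c w1 w2|c w1 w2].
- by rewrite linearD scalerDl.
- by rewrite scalerDr.
- by rewrite linearZ /= scalerA.
- by rewrite !scalerA mulrC.
Qed.

HB.mixin Record isTopologicalGroup G & Topological G & Group G := {
  mulg_continuous : continuous (fun x : G * G => (x.1 * x.2)%g) ;
  invg_continuous : continuous (fun x : G => (x^-1)%g) ;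
}.

#[short(type="topologicalGroupType")]
HB.structure Definition TopologicalGroup :=
  {G of Topological G & Group G & isTopologicalGroup G}.

HB.mixin Record isLcAlgebra (K : numFieldType) A
    & Tvs K A & GRing.Algebra K A := {
  mul_continuous : continuous (fun x : A * A => x.1 * x.2) ;
}.

#[short(type="lcAlgType")]
HB.structure Definition LcAlgebra (K : numFieldType) :=
  {A of Tvs K A & GRing.Algebra K A & isLcAlgebra K A}.

#[short(type="comLcAlgType")]
HB.structure Definition ComLcAlgebra (K : numFieldType) :=
  {A of LcAlgebra K A & GRing.ComAlgebra K A}.

Section Dynamics.
Context (R : realType).
(* [C] carries its normed topology only through the alias [C^o]. *)
Local Notation C := R[i].

Definition character_group (G : topologicalGroupType) : set (G -> C^o) :=
  [set phi : G -> C^o | [/\ continuous phi,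
                 forall g, `|phi g : C| = 1
               & forall g h, phi (g * h)%g = (phi g : C) * (phi h : C)]].

(* Invertibility of each [dyn g] follows from the group law. *)
Record dynamical_system (A : lcAlgType C) (G : topologicalGroupType) := {
  dyn :> G -> {lrmorphism A -> A} ;
  dyn1 : forall a, dyn 1%g a = a ;
  dynM : forall g h a, dyn (g * h)%g a = dyn g (dyn h a) ;
  dyn_continuous : continuous (fun x : G * A => dyn x.1 x.2) }.

Record representation (G : topologicalGroupType) (V : tvsType C) := {
  rep :> G -> {linear V -> V} ;
  rep1 : forall v, rep 1%g v = v ;
  repM : forall g h v, rep (g * h)%g v = rep g (rep h v) ;
  rep_continuous : continuous (fun x : G * V => rep x.1 x.2) }.

(* As in [Hom_alg (A, C) \ {0}], neither [chi 1 = 1] nor continuity is required;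
   the former follows from [chi != 0]. *)
Definition spectrum (A : lcAlgType C) : set {linear A -> C^o} :=
  [set chi | (forall a b, chi (a * b) = (chi a : C) * (chi b : C)) /\
             exists a, chi a != 0].

Definition isotypic (A : lcAlgType C) (G : topologicalGroupType)
    (alpha : dynamical_system A G) (phi : G -> C^o) : set A :=
  [set a | forall g, alpha g a = (phi g : C) *: a].

Definition invertible (A : lcAlgType C) (a : A) : Prop :=
  exists b, a * b = 1 /\ b * a = 1.

Definition point_separating (G : topologicalGroupType) (J : Type)
    (V : J -> tvsType C) (pi : forall j, representation G (V j)) : Prop :=
  forall g : G, g <> 1%g -> exists j, exists v, pi j g v <> v.

Definition invariant_tensors (A : lcAlgType C) (G : topologicalGroupType)
    (alpha : dynamical_system A G) (V : tvsType C) (pi : representation G V) :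
    set (tensor A V) :=
  [set s | forall g, tens_map (alpha g) (pi g) s = s].

(* Representation spaces are Hausdorff, which [tvsType] does not impose: on an
   indiscrete space the continuity of a representation would be vacuous. *)
Definition free_system (A : comLcAlgType C) (G : topologicalGroupType)
    (alpha : dynamical_system A G) : Prop :=
  exists (J : Type) (V : J -> tvsType C) (pi : forall j, representation G (V j)),
    [/\ forall j, hausdorff_space (V j),
        point_separating pi
      & forall j (chi : {linear A -> C^o}), spectrum chi ->
          set_surj (invariant_tensors alpha (pi j)) [set: V j]
            (tens_eval (V := V j) chi)].

End Dynamics.

(* Main.v *)
Require Import Defs.
From mathcomp Require Import all_boot all_order all_algebra.
From mathcomp Require Import complex.
From mathcomp Require Import boolp classical_sets functions reals.
From mathcomp Require Import topology normedtype derive.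
From mathcomp Require Import ring lra.
Import Order.TTheory GRing.Theory Num.Theory.
Import numFieldNormedType.Exports.

Set Implicit Arguments.
Unset Strict Implicit.
Unset Printing Implicit Defensive.

Local Open Scope classical_set_scope.
Local Open Scope ring_scope.

(** The representations that witness freeness are the continuous characters
    [chi] of [G], each acting by scaling on the complex line.  If [a] is an
    invertible element of the isotypic component of the inverse of [chi], then
    the tensor of [a] with any vector is invariant; and a nonzero multiplicative
    functional does not vanish at [a], so that rescaling this tensor reaches
    every vector of the line.  What remains is that the characters of a compact
    Hausdorff abelian group separate points ([characters_separate_points]).

    Every continuous function on [G] has averages of translates uniformly close
    to a constant, its mean ([existence_of_mean]).  Given [g] other than [1],
    let [k] be continuous with different values at [1] and [g].  The
    autocorrelation [F] of the difference of [k] and its translate by [g] is continuous and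
    positive definite, and [F 1] is positive.  Consider all positive definite
    [phi] with [phi 1 = 1], continuous or not.  They form a convex set that is
    compact for pointwise convergence.  The mean of [F * phi], expressed as the
    infimum over finite families [s] of the squared norm of an average, is
    affine and upper semicontinuous in [phi], so it has a maximum [c], attained
    at an extreme point ([exists_extreme_max]); and [c] is positive because [phi] may
    be [F] itself, normalised.

    An extreme point satisfies d'Alembert's equation
    [phi (x * y) + phi (x / y) = 2 * phi x * phi y] ([exists_cosine]), hence is
    the real part of a homomorphism to the unit circle ([cosine_sine]).  Because
    [c] is positive, this homomorphism correlates with the continuous function
    [F], which forces its continuity ([cosine_near1]); and because [F] is a
    second difference in the direction [g], it is orthogonal to all [g]-periodic
    functions, so the value of the homomorphism at [g] is not [1]
    ([cosine_neq1]). *)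

(** * Averages over finite families of group elements *)

Section Averages.
Context (R : realType) (G : groupType).
Implicit Types (s t : seq G) (f h : G -> R).

(** A nonempty sequence, possibly with repetitions, stands for the uniform
    probability measure on its entries; [conv] is then the convolution of two
    such measures. *)
Definition avg s f : R := (\sum_(x <- s) f x) / (size s)%:R.

Definition conv s t : seq G := [seq (x * y)%g | x <- s, y <- t].

Lemma conv_neq0 s t : s != [::] -> t != [::] -> conv s t != [::].
Proof. by rewrite -!size_eq0 size_allpairs muln_eq0 => /negPf-> /negPf->. Qed.

Lemma eq_avg s f h : f =1 h -> avg s f = avg s h.
Proof. by move=> fh; rewrite /avg (eq_bigr h). Qed.

Lemma avgD s f h : avg s (fun x => f x + h x) = avg s f + avg s h.
Proof. by rewrite /avg big_split mulrDl. Qed.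

Lemma avgZ s a f : avg s (fun x => a * f x) = a * avg s f.
Proof. by rewrite /avg -mulr_sumr mulrA. Qed.

Lemma avgB s f h : avg s (fun x => f x - h x) = avg s f - avg s h.
Proof. by rewrite /avg sumrB mulrBl. Qed.

Lemma avg_cst s a : s != [::] -> avg s (fun=> a) = a.
Proof.
rewrite -size_eq0 => s0; rewrite /avg big_const_seq count_predT iter_addr_0.
by rewrite -[a *+ _]mulr_natr mulfK // pnatr_eq0.
Qed.

Lemma le_avg s f h : (forall x, f x <= h x) -> avg s f <= avg s h.
Proof. move=> fh; apply: ler_wpM2r; first by rewrite invr_ge0 ler0n.
by apply: ler_sum => x _. Qed.

Lemma avg_ge s f a : s != [::] -> (forall x, a <= f x) -> a <= avg s f.
Proof. by move=> s0 fa; rewrite -(avg_cst a s0); exact: le_avg. Qed.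

Lemma avg_le s f a : s != [::] -> (forall x, f x <= a) -> avg s f <= a.
Proof. by move=> s0 fa; rewrite -(avg_cst a s0); exact: le_avg. Qed.

Lemma avgC s t (f : G -> G -> R) :
  avg s (fun x => avg t (f x)) = avg t (fun y => avg s (f ^~ y)).
Proof.
rewrite /avg -!mulr_suml exchange_big /= -!mulrA; congr (_ * _).
exact: mulrC.
Qed.

Lemma avg_conv s t f :
  avg (conv s t) f = avg s (fun x => avg t (fun y => f (x * y)%g)).
Proof.
rewrite /avg size_allpairs natrM invfM mulrA -!mulr_suml big_allpairs_dep.
by rewrite mulrAC.
Qed.

Lemma avg_convC s t f : (forall g h : G, (g * h)%g = (h * g)%g) ->
  avg (conv s t) f = avg (conv t s) f.
Proof.
move=> mulgC; rewrite !avg_conv avgC; apply: eq_avg => x; apply: eq_avg => y.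
by rewrite mulgC.
Qed.

Lemma avg2 x y f : avg [:: x; y] f = (f x + f y) / 2.
Proof. by rewrite /avg !big_cons big_nil addr0. Qed.

(** The lower bound that a covering argument provides: one good entry of [s]
    lifts the average of [f] above the uniform bound [a]. *)
Lemma avg_ge_one s f a b x : x \in s -> (forall y, a <= f y) -> a + b <= f x ->
  a + b / (size s)%:R <= avg s f.
Proof.
move=> xs af bf; have s0 : s != [::] by case: s xs.
rewrite -[a in X in X <= _](avg_cst a s0) /avg -mulrDl.
apply: ler_wpM2r; first by rewrite invr_ge0 ler0n.
rewrite !(big_rem x xs) /=.
have := @ler_sum R _ (rem x s) xpredT (fun=> a) f (fun y _ => af y).
by move=> ?; lra.
Qed.

End Averages.

(** * Invariant means *)

Section Means.
Context (R : realType) (G : groupType).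
Hypothesis mulgC : forall g h : G, (g * h)%g = (h * g)%g.
Implicit Types (s t : seq G) (f h : G -> R).

(** Von Neumann's mean: some average of translates of [f] is uniformly close to
    the constant [c]. *)
Definition has_mean f (c : R) := forall e, 0 < e ->
  exists2 s, s != [::] & forall x, `|avg s (fun y => f (y * x)%g) - c| <= e.

Lemma avg_dist s f c e : s != [::] -> (forall x, `|f x - c| <= e) ->
  `|avg s f - c| <= e.
Proof.
move=> s0 fc; rewrite ler_distl; apply/andP; split.
  rewrite -[leLHS](avg_cst _ s0); apply: le_avg => x.
  by have := fc x; rewrite ler_distl => /andP[].
rewrite -[leRHS](avg_cst _ s0); apply: le_avg => x.
by have := fc x; rewrite ler_distl => /andP[].
Qed.

(** Averaging once more, on either side, does not spoil the approximation; this
    is where commutativity enters, and it makes the mean unique and additive. *)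
Lemma avg_conv_distr s t f c e : s != [::] ->
  (forall x, `|avg t (fun y => f (y * x)%g) - c| <= e) ->
  forall x, `|avg (conv s t) (fun y => f (y * x)%g) - c| <= e.
Proof.
move=> s0 tc x; rewrite avg_conv; apply: avg_dist => // a.
rewrite (eq_avg _ (h := fun y => f (y * (a * x))%g)) // => y.
by rewrite mulgA (mulgC a).
Qed.

Lemma avg_conv_distl s t f c e : t != [::] ->
  (forall x, `|avg s (fun y => f (y * x)%g) - c| <= e) ->
  forall x, `|avg (conv s t) (fun y => f (y * x)%g) - c| <= e.
Proof.
move=> t0 sc x; rewrite avg_conv avgC; apply: avg_dist => // a.
by rewrite (eq_avg _ (h := fun y => f (y * (a * x))%g)) // => y; rewrite mulgA.
Qed.

Lemma eq_mean f h c : f =1 h -> has_mean f c -> has_mean h c.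
Proof. by move=> /funext->. Qed.

Lemma mean_cst c : has_mean (fun=> c) c.
Proof.
by move=> e e0; exists [:: 1%g] => // x; rewrite avg_cst // subrr normr0 ltW.
Qed.

Lemma meanD f h c d : has_mean f c -> has_mean h d ->
  has_mean (fun x => f x + h x) (c + d).
Proof.
move=> fc hd e e0; have e2 : 0 < e / 2 by lra.
have [s s0 sc] := fc _ e2; have [t t0 td] := hd _ e2.
exists (conv s t) => [|x]; first exact: conv_neq0.
rewrite avgD opprD addrACA (le_trans (ler_normD _ _)) //.
have := avg_conv_distl t0 sc x; have := avg_conv_distr s0 td x.
by move=> ? ?; lra.
Qed.

Lemma meanZ a f c : has_mean f c -> has_mean (fun x => a * f x) (a * c).
Proof.
move=> fc e e0; have a0 : 0 < `|a| + 1 by rewrite ltr_wpDl.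
have [s s0 sc] := fc (e / (`|a| + 1)) (divr_gt0 e0 a0).
exists s => // x; rewrite avgZ -mulrBr normrM.
apply: le_trans (_ : (`|a| + 1) * (e / (`|a| + 1)) <= _); last first.
  by rewrite mulrC divfK // gt_eqF.
by apply: ler_pM => //; rewrite lerDl.
Qed.

Lemma meanB f h c d : has_mean f c -> has_mean h d ->
  has_mean (fun x => f x - h x) (c - d).
Proof.
move=> fc /(meanZ (-1)) hd; rewrite -[- d]mulN1r.
by apply: eq_mean (meanD fc hd) => x; rewrite mulN1r.
Qed.

Lemma mean_sum (I : Type) (r : seq I) (f : I -> G -> R) c :
  (forall i, has_mean (f i) (c i)) ->
  has_mean (fun x => \sum_(i <- r) f i x) (\sum_(i <- r) c i).
Proof.
move=> fc; elim: r => [|i r IHr].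
  by rewrite big_nil; apply: eq_mean (mean_cst 0) => x; rewrite big_nil.
rewrite big_cons; apply: eq_mean (meanD (fc i) IHr) => x.
by rewrite big_cons.
Qed.

Lemma mean_shift a f c : has_mean f c -> has_mean (fun x => f (a * x)%g) c.
Proof.
move=> fc e e0; have [s s0 sc] := fc e e0; exists s => // x.
rewrite (eq_avg _ (h := fun y => f (y * (a * x))%g)) // => y.
by rewrite !mulgA (mulgC a).
Qed.

Lemma mean_ge t f c m : t != [::] -> has_mean f c ->
  (forall x, m <= avg t (fun y => f (y * x)%g)) -> m <= c.
Proof.
move=> t0 fc mf; apply/ler_addgt0Pr => e e0; have [s s0 sc] := fc e e0.
have := avg_conv_distl t0 sc 1%g; rewrite ler_distl => /andP[_].
apply: le_trans; rewrite avg_conv -[leLHS](avg_cst _ s0); apply: le_avg => a.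
rewrite (eq_avg _ (h := fun y => f (y * a)%g)) // => y.
by rewrite mulg1 mulgC.
Qed.

Lemma mean_ge0 f c : has_mean f c -> (forall x, 0 <= f x) -> 0 <= c.
Proof.
move=> fc f0; apply: (mean_ge (t := [:: 1%g])) fc _ => // x.
by rewrite /avg big_seq1 divr_ge0.
Qed.

Lemma le_mean f h c d : has_mean f c -> has_mean h d ->
  (forall x, f x <= h x) -> c <= d.
Proof.
move=> fc hd fh; rewrite -subr_ge0; apply: mean_ge0 (meanB hd fc) _ => x.
by rewrite subr_ge0.
Qed.

Lemma mean_norm_le f c e : has_mean f c -> (forall x, `|f x| <= e) -> `|c| <= e.
Proof.
move=> fc fe; rewrite ler_norml; apply/andP; split.
  apply: le_mean (mean_cst _) fc _ => x.
  by have := fe x; rewrite ler_norml => /andP[].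
apply: le_mean fc (mean_cst _) _ => x.
by have := fe x; rewrite ler_norml => /andP[].
Qed.

Lemma mean_unique f c d : has_mean f c -> has_mean f d -> c = d.
Proof.
move=> fc fd; apply/le_anti/andP.
by split; [exact: le_mean fc fd _ | exact: le_mean fd fc _].
Qed.

End Means.

(** * Means of continuous functions on a compact abelian group *)

Section CompactMeans.
Context (R : realType) (G : topologicalGroupType).
Hypotheses (mulgC : forall g h : G, (g * h)%g = (h * g)%g)
  (G_compact : compact [set: G]).
Implicit Types (f h : G -> R).

Lemma mulgl_continuous (a : G) : continuous (fun x : G => (x * a)%g).
Proof.
move=> x; apply: (@continuous_comp _ _ _ (fun x => (x, a))
  (fun p => p.1 * p.2)%g).
  by apply: cvg_pair; [exact: cvg_id | exact: cvg_cst].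
exact: mulg_continuous.
Qed.

Lemma translates_cover (U : set G) : nbhs 1%g U ->
  exists t : seq G, forall z, exists2 y, y \in t & U (z * y)%g.
Proof.
move=> U1.
(* Compactness in its near-covering form, along the filter of all sufficiently
   large finite families. *)
pose F : set_system (seq G) :=
  filter_from setT (fun r : seq G => [set t : seq G | {subset r <= t}]).
have FF : Filter F.
  apply: filter_from_filter => [|r r' _ _]; first by exists [::].
  by exists (r ++ r') => // t rt; split=> y yr; apply: rt;
    rewrite mem_cat yr ?orbT.
have /compact_near_coveringP/(_ _ F (fun t z => exists2 y, y \in t &
  U (z * y)%g) FF) := G_compact.
case=> [x _|r _ rP]; last by exists r => z; exact: (rP r).
have Ux : nbhs x ((fun z => z * x^-1)%g @^-1` U).
  by apply: mulgl_continuous; rewrite mulgV.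
exists ((fun z => z * x^-1)%g @^-1` U,
  [set t : seq G | {subset [:: x^-1%g] <= t}]).
  by split=> //; exists [:: x^-1%g].
case=> z t /= [Uz xt]; exists x^-1%g => //; apply: xt; exact: mem_head.
Qed.

(** On a compact group continuity is equivalent to this translation-uniform
    form, which averages, products and correlations inherit directly. *)
Definition unif_cont f := forall e, 0 < e ->
  \forall u \near (1%g : G), forall x, `|f (u * x)%g - f x| <= e.

Lemma continuous_unif_cont f : continuous f -> unif_cont f.
Proof.
move=> cf e e0; have mulC : continuous (fun p : G * G => p.2 * p.1)%g.
  move=> p; apply: (@continuous_comp _ _ _ (fun p : G * G => (p.2, p.1))
    (fun p => p.1 * p.2)%g); last exact: mulg_continuous.
  by apply: cvg_pair; [exact: cvg_snd | exact: cvg_fst].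
have cF : continuous (fun p : G * G => f (p.2 * p.1)%g - f p.1).
  move=> p; apply: cvgB.
    by apply: (@continuous_comp _ _ _ (fun p : G * G => p.2 * p.1)%g f);
      [exact: mulC | exact: cf].
  by apply: (@continuous_comp _ _ _ (fun p : G * G => p.1) f);
    [exact: cvg_fst | exact: cf].
have /compact_near_coveringP cov := G_compact.
apply: filterS (cov G (nbhs (1%g : G))
  (fun u x => `|f (u * x)%g - f x| <= e) _ _) => [u uP x|x _]; first exact: uP.
have /cvgrPdist_lt/(_ _ e0) := cF (x, 1%g : G).
apply: filterS => -[z u] /=.
by rewrite mul1g subrr sub0r normrN => /ltW.
Qed.

(** The mean is the supremum [c] of the lower bounds of averages of translates
    of [f].  An average [f1] whose lower bound nearly equals [c] cannot exceed
    [c] much anywhere: by uniform continuity it would do so on a whole translate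
    of a neighbourhood of [1], and averaging [f1] over a finite cover by such
    translates would push the lower bound above [c]. *)
Lemma existence_of_mean f b : (forall x, `|f x| <= b) -> unif_cont f ->
  exists c, has_mean f c.
Proof.
move=> fb uf.
pose L : set R := [set m | exists2 s, s != [::] &
  forall x, m <= avg s (fun y => f (y * x)%g)].
have L0 : L !=set0.
  exists (- b), [:: 1%g] => // x; rewrite /avg big_seq1 divr1.
  by have := fb (1 * x)%g; rewrite ler_norml => /andP[].
have Lb : has_ubound L.
  exists b => m [s s0 /(_ 1%g) /le_trans]; apply.
  rewrite -[leRHS](avg_cst _ s0); apply: le_avg => x.
  exact: le_trans (ler_norm _) (fb _).
exists (sup L) => e e0; set c := sup L.
have e2 : 0 < e / 2 by lra.
have [t tP] := translates_cover (uf _ e2).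
have t0 : t != [::] by have [y] := tP 1%g; case: t {tP}.
have N1 : 1 <= (size t)%:R :> R by rewrite ler1n lt0n size_eq0.
have N0 : 0 < (size t)%:R :> R by apply: lt_le_trans N1.
have d0 : 0 < e / 2 / (size t)%:R by rewrite divr_gt0.
have de : e / 2 / (size t)%:R <= e.
  by rewrite ler_pdivrMr //; nra.
have [m [s s0 ms] mc] := sup_adherent d0 (conj L0 Lb).
have mle : m <= c by apply: ub_le_sup => //; exists s.
exists s => // x; rewrite ler_distl; apply/andP; split.
  by apply: le_trans (ms x); move: mc; rewrite -/c; lra.
rewrite leNgt; apply/negP => cx.
set f1 := fun z => avg s (fun y => f (y * z)%g).
have uf1 u z : (forall x, `|f (u * x)%g - f x| <= e / 2) ->
    f1 z - e / 2 <= f1 (u * z)%g.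
  move=> ue; suff : `|f1 (u * z)%g - f1 z - 0| <= e / 2.
    by rewrite subr0 ler_distl => /andP[].
  rewrite -avgB; apply: avg_dist => // y; rewrite subr0.
  by rewrite mulgA (mulgC y) -mulgA.
have : L (m + e / 2 / (size t)%:R).
  exists (conv t s) => [|z]; first exact: conv_neq0.
  rewrite avg_conv.
  rewrite (eq_avg _ (h := fun y => f1 (y * z)%g)); last first.
    by move=> y; apply: eq_avg => y'; rewrite (mulgC y) mulgA.
  have [y yt Uy] := tP (z * x^-1)%g.
  apply: (avg_ge_one yt) => [y'|]; first exact: ms.
  rewrite (_ : y * z = z * x^-1 * y * x)%g; last first.
    by rewrite -[RHS]mulgA (mulgC y x) [RHS]mulgA mulgVK mulgC.
  apply: le_trans (uf1 _ x Uy).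
  by move: mle cx; rewrite -/(f1 x); lra.
move=> /(ub_le_sup Lb); move: mc; rewrite -/c; lra.
Qed.

(** Finitely many translates of a neighbourhood on which [f] is bounded below
    cover the group, so some average of [f] is bounded below everywhere. *)
Lemma mean_gt0 f c : has_mean f c -> unif_cont f -> (forall x, 0 <= f x) ->
  0 < f 1%g -> 0 < c.
Proof.
move=> fc uf f0 f1; have e0 : 0 < f 1%g / 2 by lra.
have [t tP] := translates_cover (uf _ e0).
have t0 : t != [::] by have [y] := tP 1%g; case: t {tP}.
have N0 : 0 < (size t)%:R :> R by rewrite ltr0n lt0n size_eq0.
apply: lt_le_trans (divr_gt0 e0 N0) _; apply: (mean_ge mulgC t0 fc) => x.
have [y yt /(_ 1%g)] := tP x; rewrite mulg1 (mulgC x) ler_distl => /andP[fy _].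
rewrite -[leLHS]add0r; apply: (avg_ge_one yt) => [y'|]; first exact: f0.
by move: fy; lra.
Qed.

Lemma unif_cont_shift a f : unif_cont f -> unif_cont (fun x => f (a * x)%g).
Proof.
move=> uf e /uf; apply: filterS => u ue x.
by rewrite (_ : a * (u * x) = u * (a * x))%g // !mulgA (mulgC a).
Qed.

Lemma unif_contB f h : unif_cont f -> unif_cont h ->
  unif_cont (fun x => f x - h x).
Proof.
move=> uf uh e e0; have e2 : 0 < e / 2 by lra.
apply: filterS2 (uf _ e2) (uh _ e2) => u fu hu x.
rewrite (_ : _ - _ - _ = f (u * x)%g - f x - (h (u * x)%g - h x)); last by ring.
by rewrite (le_trans (ler_normB _ _)) //; have := fu x; have := hu x; lra.
Qed.

Lemma unif_contM f h b : 0 < b -> (forall x, `|f x| <= b) ->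
  (forall x, `|h x| <= b) -> unif_cont f -> unif_cont h ->
  unif_cont (fun x => f x * h x).
Proof.
move=> b0 fb hb uf uh e e0.
have e2 : 0 < e / (2 * b) by rewrite divr_gt0 // mulr_gt0.
apply: filterS2 (uf _ e2) (uh _ e2) => u fu hu x.
have -> : f (u * x)%g * h (u * x)%g - f x * h x =
    f (u * x)%g * (h (u * x)%g - h x) + (f (u * x)%g - f x) * h x by ring.
have -> : e = b * (e / (2 * b)) + e / (2 * b) * b.
  by field; rewrite gt_eqF.
rewrite (le_trans (ler_normD _ _)) // !normrM.
by apply: lerD; apply: ler_pM.
Qed.

End CompactMeans.

(** * Extreme points of compact sets of real functions *)

Section ClosedConditions.
Context (R : realType) (T : topologicalType).

Lemma sum_continuous (I : Type) (r : seq I)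
    (f : I -> T -> R) : (forall i, continuous (f i)) ->
  continuous (fun u => \sum_(i <- r) f i u).
Proof.
move=> cf; elim: r => [|i r IHr] u.
  rewrite (_ : (fun u => _) = fun=> 0); first exact: cvg_cst.
  by apply/funext => v; rewrite big_nil.
rewrite (_ : (fun u => _) = fun u => f i u + \sum_(j <- r) f j u).
  by apply: cvgD; [exact: cf | exact: IHr].
by apply/funext => v; rewrite big_cons.
Qed.

Lemma scaled_continuous a (f : T -> R) : continuous f ->
  continuous (fun u => a * f u).
Proof. by move=> cf u; apply: cvgM; [exact: cvg_cst | exact: cf]. Qed.

Lemma const_continuous (a : R) : continuous (fun _ : T => a).
Proof. by move=> u; exact: cvg_cst. Qed.

Lemma closed_forall (I : Type) (P : I -> T -> Prop) :
  (forall i, closed [set u | P i u]) -> closed [set u | forall i, P i u].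
Proof.
move=> cP; rewrite (_ : [set u | _] = \bigcap_(i in setT) [set u | P i u]).
  by apply: closed_bigI => i _; exact: cP.
by apply/seteqP; split=> u Pu i //=; exact: Pu.
Qed.

Lemma closed_le_continuous (f h : T -> R) :
  continuous f -> continuous h -> closed [set u | f u <= h u].
Proof.
move=> cf ch.
rewrite (_ : [set u | _] = (fun u => h u - f u) @^-1` [set y | 0 <= y]).
  apply: preimage_closed; last exact: closed_ge.
  by move=> u _; apply: cvgB; [exact: ch | exact: cf].
by apply/seteqP; split=> u /=; rewrite subr_ge0.
Qed.

Lemma closed_eq_continuous (f h : T -> R) :
  continuous f -> continuous h -> closed [set u | f u = h u].
Proof.
move=> cf ch; rewrite (_ : [set u | _] =
  [set u | f u <= h u] `&` [set u | h u <= f u]).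
  by apply: closedI; exact: closed_le_continuous.
by apply/seteqP; split=> u /= => [->//|[? ?]]; exact/le_anti/andP.
Qed.

End ClosedConditions.

Section ExtremePoint.
Context (R : realType) (I : eqType).
Local Notation X := ({ptws I -> R}).
Implicit Types (A : set X) (u v w : X).

Lemma coord_continuous (i : I) : continuous (fun u : X => (u i : R)).
Proof. exact: (@proj_continuous I (fun=> R) i). Qed.

(** Closed faces, with the extremality tested on midpoints only. *)
Definition face (K A : set X) := [/\ closed A, A !=set0, A `<=` K &
  forall u v w, A u -> K v -> K w -> (forall i, v i + w i = 2 * u i) ->
    A v /\ A w].

Definition argmax A (i : I) : set X :=
  A `&` [set u | forall v, A v -> v i <= u i].

Lemma face_argmax K A i : compact K -> face K A -> face K (argmax A i).
Proof.
move=> cK [clA A0 AK fA].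
have cA : compact A := subclosed_compact clA cK AK.
have [m /set_mem Am mmax] :
    exists2 m, m \in A & forall v, v \in A -> v i <= m i.
  apply: (compact_EVT_max (f := fun u : X => u i)) => //.
  by apply: continuous_subspaceT; exact: coord_continuous.
have {}mmax v : A v -> v i <= m i by move=> Av; apply: mmax; exact/mem_set.
have -> : argmax A i = A `&` (fun u : X => u i) @^-1` [set x | m i <= x].
  apply/seteqP; split=> u [Au /= um]; split=> //=; first exact: um.
  by move=> v /mmax /le_trans; exact.
split.
- apply: closedI => //; apply: preimage_closed; last exact: closed_ge.
  by move=> x _; exact: coord_continuous.
- by exists m; split => /=.
- by move=> u [/AK].
- move=> u v w [Au /= mu] Kv Kw vwu; have [Av Aw] := fA u v w Au Kv Kw vwu.
  have := vwu i; have := mmax _ Av; have := mmax _ Aw => ? ? ?.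
  by split; split=> //=; lra.
Qed.

(** Krein and Milman's argument: a minimal closed face inside the face on which
    coordinate [i0] is maximal is a single point, since each coordinate is
    constant on it. *)
Lemma exists_extreme_max (K : set X) (i0 : I) : closed K -> compact K ->
  K !=set0 -> exists u, [/\ K u, forall v, K v -> v i0 <= u i0 &
    forall v w, K v -> K w -> (forall i, v i + w i = 2 * u i) ->
      forall i, v i = u i].
Proof.
move=> clK cK K0; have fK : face K K by split.
pose K1 := argmax K i0; have fK1 : face K K1 by exact: face_argmax.
have [clK1 K10 K1K fK1'] := fK1.
(* Faces are handled through their complements in [K1], which turns minimality
   into maximality. *)
have [F FP Ftot|S [fS Smax]] := @Zorn_bigcup X [set S | face K (K1 `\` S)].
  have [->|/set0P[S0 FS0]] := eqVneq F set0.
    by rewrite bigcup_set0 /= setD0.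
  have clF S : F S -> closed (K1 `\` S) by move=> /FP[].
  pose B : set_system X := filter_from F (fun S => K1 `\` S).
  have BP : ProperFilter B.
    apply: filter_from_proper => [|S /FP[]//].
    apply: filter_from_filter; first by exists S0.
    move=> S T FS FT; have [ST|TS] := Ftot _ _ FS FT.
      by exists T => // u [K1u Tu]; do !split=> //; move=> /ST.
    by exists S => // u [K1u Su]; do !split=> //; move=> /TS.
  have BK1 : B K1 by exists S0 => // u [].
  have cK1 : compact K1 := subclosed_compact clK1 cK K1K.
  have [p [K1p clp]] := cK1 B BP BK1.
  have Fp S : F S -> (K1 `\` S) p.
    move=> FS; apply: (clF S FS) => V Vp; apply: clp => //; exists S => //.
  split.
  - rewrite (_ : _ `\` _ = \bigcap_(S in F) (K1 `\` S)).
      by apply: closed_bigI => S /clF.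
    apply/seteqP; split=> [u [K1u Fu] S FS|u Fu].
      by split=> // Su; apply: Fu; exists S.
    by split=> [|[S FS Su]]; [case: (Fu S0 FS0) | case: (Fu S FS)].
  - by exists p; split=> // -[S FS Sp]; case: (Fp S FS).
  - by move=> u [/K1K].
  - move=> u v w [K1u Fu] Kv Kw vwu.
    have FS S : F S -> ~ S v /\ ~ S w.
      move=> FS; have [_ _ _ fS] := FP _ FS.
      have [] := fS u v w _ Kv Kw vwu; last by move=> [_ ?] [].
      by split=> // Su; apply: Fu; exists S.
    have [K1v K1w] := fK1' u v w K1u Kv Kw vwu.
    by split; split=> // -[S /FS []].
have [_ [u [K1u Su]] _ fS'] := fS; exists u; split.
- exact: K1K.
- by case: K1u.
move=> v w Kv Kw vwu i.
have const x y : (K1 `\` S) x -> (K1 `\` S) y -> x i <= y i.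
  move=> Ax Ay; suff: argmax (K1 `\` S) i y by case=> _; exact.
  apply: contrapT => nBy; apply: (Smax (~` argmax (K1 `\` S) i)).
    split=> [z Sz [[_ /(_ Sz)]]//|/(_ y nBy) Sy]; by case: Ay.
  rewrite /= setDE setCK setIidr; first exact: face_argmax.
  by move=> z [[]].
have [Av Aw] := fS' u v w (conj K1u Su) Kv Kw vwu.
by apply/le_anti/andP; split; exact: const.
Qed.

End ExtremePoint.

(** * Positive definite functions *)

Section PositiveDefinite.
Context (R : realType) (G : groupType).
Hypothesis mulgC : forall g h : G, (g * h)%g = (h * g)%g.
Implicit Types (s t : seq G) (r : seq (R * G)) (psi phi : G -> R) (x y z g : G).

Definition gram psi r : R :=
  \sum_(p <- r) \sum_(q <- r) p.1 * q.1 * psi (p.2 * q.2^-1)%g.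

(** Real parts of the usual complex positive definite functions: evenness
    replaces Hermitian symmetry. *)
Definition pos_def psi :=
  (forall x, psi x^-1%g = psi x) /\ forall r, 0 <= gram psi r.

Lemma pos_def_norm_le psi x : pos_def psi -> `|psi x| <= psi 1%g.
Proof.
move=> [ev pd]; have := pd [:: (1, 1%g); (1, x)].
have := pd [:: (1, 1%g); (-1, x)].
rewrite /gram !big_cons !big_nil /= !mulgV mul1g invg1 mulg1 ev => ? ?.
by rewrite ler_norml; lra.
Qed.

Lemma pos_defD psi phi : pos_def psi -> pos_def phi ->
  pos_def (fun x => psi x + phi x).
Proof.
move=> [ev1 pd1] [ev2 pd2]; split=> [x|r]; first by rewrite ev1 ev2.
rewrite (_ : gram _ r = gram psi r + gram phi r) ?addr_ge0 //.
rewrite /gram -big_split /=; apply: eq_bigr => p _; rewrite -big_split /=.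
by apply: eq_bigr => q _; rewrite mulrDr.
Qed.

Lemma pos_defZ a psi : 0 <= a -> pos_def psi -> pos_def (fun x => a * psi x).
Proof.
move=> a0 [ev pd]; split=> [x|r]; first by rewrite ev.
rewrite (_ : gram _ r = a * gram psi r) ?mulr_ge0 //.
rewrite /gram mulr_sumr; apply: eq_bigr => p _; rewrite mulr_sumr.
by apply: eq_bigr => q _; rewrite mulrCA.
Qed.

Lemma pos_def_cst1 : pos_def (fun=> 1).
Proof.
split=> // r; rewrite (_ : gram _ r = (\sum_(p <- r) p.1) ^+ 2) ?sqr_ge0 //.
rewrite expr2 mulr_suml; apply: eq_bigr => p _; rewrite mulr_sumr.
by apply: eq_bigr => q _; rewrite mulr1.
Qed.

(** If [psi] is the diagonal coefficient of a vector [xi] in a unitary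
    representation, [sandwich psi r] is that of the combination [r] of
    translates of [xi]. *)
Definition sandwich psi r z : R :=
  \sum_(p <- r) \sum_(q <- r) p.1 * q.1 * psi (p.2 * q.2^-1 * z)%g.

Lemma pos_def_sandwich psi r : pos_def psi -> pos_def (sandwich psi r).
Proof.
move=> [ev pd]; split=> [z|r'].
  rewrite /sandwich exchange_big /=.
  apply: eq_bigr => p _; apply: eq_bigr => q _.
  rewrite -ev !invgM !invgK; congr (_ * psi _); first exact: mulrC.
  by rewrite mulgC.
have := pd [seq (a.1 * p.1, (a.2 * p.2)%g) | a <- r', p <- r].
rewrite /gram big_allpairs_dep /=; congr (0 <= _).
apply: eq_bigr => a _; under eq_bigr => p _ do rewrite big_allpairs_dep /=.
rewrite exchange_big /=; apply: eq_bigr => b _.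
rewrite mulr_sumr; apply: eq_bigr => p _.
rewrite mulr_sumr; apply: eq_bigr => q _.
rewrite mulrACA [RHS]mulrA; congr (_ * psi _).
rewrite invgM -mulgA mulgC -!mulgA; congr (_ * _)%g.
by rewrite [RHS]mulgC -mulgA.
Qed.

Lemma sandwich_pair psi e g z : sandwich psi [:: (1, 1%g); (e, g)] z =
  (1 + e ^+ 2) * psi z + e * (psi (g * z)%g + psi (g^-1 * z)%g).
Proof.
rewrite /sandwich !big_cons !big_nil /= !mulgV invg1 !mul1g mulg1; ring.
Qed.

(** When [psi] is the diagonal coefficient of [xi], [smooth s psi] is that of
    the average of the translates of [xi] by [s]; its value at [1] is the square
    of the norm of this average. *)
Definition smooth s psi z : R :=
  avg s (fun x => avg s (fun y => psi (x * y^-1 * z)%g)).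

Lemma pos_def_smooth s psi : pos_def psi -> pos_def (smooth s psi).
Proof.
move=> pd; rewrite (_ : smooth s psi =
    sandwich psi [seq ((size s)%:R^-1, x) | x <- s]).
  exact: pos_def_sandwich.
apply/funext => z; rewrite /smooth /sandwich /avg big_map mulr_suml.
apply: eq_bigr => x _; rewrite big_map !mulr_suml.
by apply: eq_bigr => y _ /=; rewrite -mulrA mulrC.
Qed.

Lemma smooth_conv s t psi : smooth (conv s t) psi 1%g =
  avg t (fun x => avg t (fun y => smooth s psi (x * y^-1)%g)).
Proof.
rewrite /smooth avg_conv avgC; apply: eq_avg => a.
rewrite [RHS]avgC; apply: eq_avg => x; rewrite avg_conv avgC.
apply: eq_avg => b; apply: eq_avg => y; congr psi.
rewrite mulg1 invgM -!mulgA; congr (_ * _)%g.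
by rewrite mulgA mulgC.
Qed.

(** Averaging contracts norms. *)
Lemma smooth_conv_le s t psi : t != [::] -> pos_def psi ->
  smooth (conv s t) psi 1%g <= smooth s psi 1%g.
Proof.
move=> t0 /(pos_def_smooth s) pd; rewrite smooth_conv.
apply: avg_le => // x; apply: avg_le => // y.
exact: le_trans (ler_norm _) (pos_def_norm_le _ pd).
Qed.

Lemma smooth_convC s t psi z :
  smooth (conv s t) psi z = smooth (conv t s) psi z.
Proof.
by rewrite /smooth avg_convC //; apply: eq_avg => x; rewrite avg_convC.
Qed.

Lemma smooth_conv_pair s g psi : smooth (conv s [:: 1%g; g]) psi 1%g =
  smooth s psi 1%g / 2 + (smooth s psi g + smooth s psi g^-1%g) / 4.
Proof. rewrite smooth_conv !avg2 !mulgV invg1 mul1g mulg1; lra. Qed.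

Lemma smooth_ge0 s psi : pos_def psi -> 0 <= smooth s psi 1%g.
Proof.
by move=> /(pos_def_smooth s) /(pos_def_norm_le 1%g); exact: le_trans.
Qed.

Lemma smoothD s psi phi z :
  smooth s (fun x => psi x + phi x) z = smooth s psi z + smooth s phi z.
Proof. by rewrite /smooth -avgD; apply: eq_avg => x; rewrite avgD. Qed.

Lemma smoothZ s a psi z : smooth s (fun x => a * psi x) z = a * smooth s psi z.
Proof. by rewrite /smooth -avgZ; apply: eq_avg => x; rewrite avgZ. Qed.

Lemma le_smooth s psi phi z : (forall x, psi x <= phi x) ->
  smooth s psi z <= smooth s phi z.
Proof. by move=> le; apply: le_avg => x; apply: le_avg. Qed.

Lemma smooth_shift s psi g z :
  smooth s (fun x => psi (g * x)%g) z = smooth s psi (g * z)%g.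
Proof.
apply: eq_avg => x; apply: eq_avg => y; congr psi.
by rewrite mulgA (mulgC g (x * _)%g) -mulgA.
Qed.

End PositiveDefinite.

(** * Autocorrelation *)

Section Autocorrelation.
Context (R : realType) (G : topologicalGroupType).
Hypotheses (mulgC : forall g h : G, (g * h)%g = (h * g)%g)
  (G_compact : compact [set: G]).
Implicit Types (k h phi : G -> R) (g x y : G).

Definition autocorr k h :=
  forall x, has_mean (fun y => k (x * y)%g * k y) (h x).

Lemma autocorr_exists k : (forall x, `|k x| <= 1) -> unif_cont k ->
  exists h, autocorr k h.
Proof.
move=> k1 uk.
suff /choice[h hP] : forall x, exists c,
    has_mean (fun y => k (x * y)%g * k y) c.
  by exists h.
move=> x; apply: (existence_of_mean mulgC G_compact (b := 1)) => [y|].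
  by rewrite normrM; apply: mulr_ile1.
by apply: (unif_contM (b := 1)) => //; exact: unif_cont_shift.
Qed.

Section Theory.
Variables (k h : G -> R).
Hypothesis kh : autocorr k h.

Lemma autocorr_mean x y :
  has_mean (fun z => k (x * z)%g * k (y * z)%g) (h (x * y^-1)%g).
Proof.
apply: eq_mean (mean_shift mulgC y (kh (x * y^-1)%g)) => z.
by rewrite mulgA mulgVK.
Qed.

Lemma autocorr_even x : h x^-1%g = h x.
Proof.
apply: (mean_unique mulgC (kh _)); have := autocorr_mean 1%g x^-1%g.
by rewrite invgK mul1g; apply: eq_mean => y; rewrite mul1g mulrC.
Qed.

(** The Schur product theorem for the explicit factor [h], whose Gram matrices
    are means of matrices of rank one. *)
Lemma pos_def_autocorrM phi : pos_def phi -> pos_def (fun x => h x * phi x).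
Proof.
move=> [ev pd]; split=> [x|r]; first by rewrite autocorr_even ev.
pose F (p q : R * G) z := p.1 * q.1 * phi (p.2 * q.2^-1)%g *
  (k (p.2 * z)%g * k (q.2 * z)%g).
have mF : has_mean (fun z => \sum_(p <- r) \sum_(q <- r) F p q z)
    (gram (fun x => h x * phi x) r).
  apply: mean_sum => // p; apply: mean_sum => // q; rewrite mulrA mulrAC.
  exact: meanZ (autocorr_mean _ _).
apply: (mean_ge0 mulgC mF) => z.
have := pd [seq (p.1 * k (p.2 * z)%g, p.2) | p <- r].
rewrite /gram big_map; congr (0 <= _); apply: eq_bigr => p _.
rewrite big_map; apply: eq_bigr => q _ /=; rewrite /F; ring.
Qed.

Lemma pos_def_autocorr : pos_def h.
Proof.
have := pos_def_autocorrM (@pos_def_cst1 R G).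
by rewrite (_ : (fun x => _) = h) //; apply/funext => x; rewrite mulr1.
Qed.

Lemma autocorr_unif_cont : (forall x, `|k x| <= 1) -> unif_cont k ->
  unif_cont h.
Proof.
move=> k1 uk e e0; apply: filterS (uk e e0) => u ku x.
apply: (mean_norm_le mulgC (meanB mulgC (kh (u * x)%g) (kh x))) => y.
rewrite -mulrBl normrM -[leRHS]mulr1 ler_pM //.
by rewrite -mulgA.
Qed.

Lemma autocorr_gt0 : (forall x, `|k x| <= 1) -> unif_cont k -> k 1%g != 0 ->
  0 < h 1%g.
Proof.
move=> k1 uk k10; apply: (mean_gt0 mulgC G_compact (kh 1%g)) => [|x|].
- by apply: (unif_contM (b := 1)) => //; exact: unif_cont_shift.
- by rewrite mul1g -expr2 sqr_ge0.
- by rewrite mul1g -expr2 exprn_even_gt0.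
Qed.

(** The autocorrelation of a difference of translates is a second difference,
    which is what makes it orthogonal to every [g]-periodic function. *)
Lemma autocorr_diff g : autocorr (fun x => k (g * x)%g - k x)
  (fun x => 2 * h x - (h (g * x)%g + h (g^-1 * x)%g)).
Proof.
move=> x; have := meanB mulgC
  (meanD mulgC (autocorr_mean (g * x)%g g) (autocorr_mean x 1%g))
  (meanD mulgC (autocorr_mean (g * x)%g 1%g) (autocorr_mean x g)).
rewrite invg1 !mulg1 (mulgC g x) mulgK (mulgC x g) (mulgC x g^-1%g).
rewrite -mulr2n -[h x *+ 2]mulr_natl; apply: eq_mean => y.
rewrite !mul1g !mulgA; ring.
Qed.

End Theory.
End Autocorrelation.

(** * The cosine functional equation *)

Section Cosine.
Context (R : realType) (G : groupType).
Hypothesis mulgC : forall g h : G, (g * h)%g = (h * g)%g.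
Variable phi : G -> R.
Hypotheses (phi1 : phi 1%g = 1) (phiV : forall x, phi x^-1%g = phi x)
  (phi_le1 : forall x, `|phi x| <= 1)
  (phi_cos : forall x y,
    phi (x * y)%g + phi (x * y^-1)%g = 2 * (phi x * phi y)).

(** A bounded solution of d'Alembert's equation is the cosine of a character.
    The sine is recovered from the addition formula for the cosine, using a
    point [g] at which it does not vanish; if there is none then [phi] is itself
    multiplicative. *)
Lemma cosine_sine : exists sigma : G -> R,
  [/\ forall x y, phi (x * y)%g = phi x * phi y - sigma x * sigma y,
      forall x y, sigma (x * y)%g = sigma x * phi y + phi x * sigma y
    & forall x, phi x ^+ 2 + sigma x ^+ 2 = 1].
Proof.
have [[g pg]|nog] := pselect (exists g, phi g ^+ 2 != 1); last first.
  have sq x : phi x ^+ 2 = 1.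
    by apply: contrapT => /eqP px; apply: nog; exists x.
  exists (fun=> 0); split=> [x y|x y|x].
  - have := phi_cos x y; have := sq (x * y)%g; have := sq (x * y^-1)%g.
    have : (phi x * phi y) ^+ 2 = 1 by rewrite exprMn !sq mulr1.
    do 3! [move=> /eqP; rewrite sqrf_eq1 => /orP[]/eqP->]; lra.
  - by rewrite mulr0 mul0r addr0.
  - by rewrite sq expr0n addr0.
pose d := 1 - phi g ^+ 2.
have d0 : 0 < d.
  rewrite subr_gt0 lt_neqAle pg /= -real_normK ?num_real //.
  by rewrite expr_le1.
pose r := Num.sqrt d; have r0 : 0 < r by rewrite sqrtr_gt0.
have r2 : r ^+ 2 = d by rewrite sqr_sqrtr // ltW.
pose sigma x := (phi (x * g^-1)%g - phi (x * g)%g) / (2 * r).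
have rs x : 2 * r * sigma x = phi (x * g^-1)%g - phi (x * g)%g.
  by rewrite mulrC divfK // mulf_neq0 ?pnatr_eq0 ?gt_eqF.
have sV x : sigma x^-1%g = - sigma x.
  rewrite /sigma -mulNr opprB -(phiV (x^-1 * g)) -(phiV (x^-1 * _)).
  rewrite !invgM !invgK.
  by rewrite (mulgC g) (mulgC g^-1%g).
have ss1 x y : sigma (x * y)%g + sigma (x * y^-1)%g = 2 * (sigma x * phi y).
  transitivity (2 * ((phi (x * g^-1)%g - phi (x * g)%g) * phi y) / (2 * r)).
    rewrite /sigma -mulrDl; congr (_ / _).
  have := phi_cos (x * g^-1)%g y; have := phi_cos (x * g)%g y.
  rewrite -!(mulgA x) (mulgC g) (mulgC g y^-1%g) (mulgC g^-1%g y).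
  rewrite (mulgC g^-1%g y^-1%g) !mulgA.
  lra.
  by rewrite /sigma; ring.
have ss2 x y : sigma (x * y)%g = sigma x * phi y + phi x * sigma y.
  have := ss1 y x; have := ss1 x y; rewrite (mulgC y x).
  have <- : ((x * y^-1)^-1 = y * x^-1)%g by rewrite invgM invgK.
  rewrite sV => ? ?; lra.
have sp x y : 2 * (sigma x * sigma y) = phi (x * y^-1)%g - phi (x * y)%g.
  have h0 : 4 * d != 0 by rewrite mulf_neq0 ?pnatr_eq0 ?gt_eqF.
  apply: (mulfI h0); rewrite -r2.
  rewrite (_ : _ * _ * _ = 2 * ((2 * r * sigma x) * (2 * r * sigma y)));
    last by ring.
  rewrite !rs.
  have fact u v : 2 * (phi (x * u)%g * phi (y * v)%g) =
      phi (x * y * (u * v))%g + phi (x * y^-1 * (u * v^-1))%g.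
    rewrite -phi_cos; congr (phi _ + phi _).
      by rewrite -!mulgA; congr (_ * _)%g; rewrite !mulgA (mulgC u).
    rewrite invgM -!mulgA; congr (_ * _)%g.
    by rewrite (mulgC v^-1%g) !mulgA (mulgC u).
  have := fact g^-1%g g^-1%g; have := fact g g.
  have := fact g^-1%g g; have := fact g g^-1%g.
  have := phi_cos (x * y)%g (g * g)%g; have := phi_cos (x * y^-1)%g (g * g)%g.
  have := phi_cos g g.
  rewrite !invgM !invgK !mulgV !mulVg !mulg1 phi1 r2 /d expr2.
  set a := phi (x * y)%g; set b := phi (x * y^-1)%g; set c := phi (g * g)%g.
  nra.
exists sigma; split=> [x y|x y|x]; last 2 first.
- exact: ss2.
- have := sp x x; have := phi_cos x x; rewrite mulgV phi1 !expr2; lra.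
by have := sp x y; have := phi_cos x y; lra.
Qed.

End Cosine.

(** * An extremal positive definite function *)

Section Extremal.
Context (R : realType) (G : groupType).
Hypothesis mulgC : forall g h : G, (g * h)%g = (h * g)%g.
Local Notation X := ({ptws option G -> R}).
Implicit Types (u v w : X) (phi psi : G -> R) (s t : seq G).

Lemma avg_continuous s (f : G -> X -> R) : (forall x, continuous (f x)) ->
  continuous (fun u => avg s (f ^~ u)).
Proof.
move=> cf; rewrite (_ : (fun u => _) =
  fun u => (size s)%:R^-1 * \sum_(x <- s) f x u).
  by apply: scaled_continuous; exact: sum_continuous.
by apply/funext => u; rewrite /avg mulrC.
Qed.

Variable F : G -> R.
Hypotheses (F_mul : forall phi, pos_def phi -> pos_def (fun x => F x * phi x))
  (F1 : 0 < F 1%g).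
Variable m : R.
Hypotheses (m0 : 0 < m)
  (F_sqr : forall s, s != [::] -> m <= smooth s (fun x => F x * F x) 1%g).

(** Its infimum over [s] plays the role of the mean of [F * phi]. *)
Definition mass s phi : R := smooth s (fun x => F x * phi x) 1%g.

(** The hypograph, over the normalised positive definite functions [phi], of the
    infimum of [mass s phi] over all [s].  The infimum is merely upper
    semicontinuous in [phi]; making the bound a coordinate turns its
    maximisation into that of a coordinate. *)
Definition hypograph : set X := [set u : X |
  [/\ pos_def (u \o Some), u (Some 1%g) = 1, 0 <= u None &
      forall s, s != [::] -> u None <= mass s (u \o Some)]].

Lemma mass_nil1 phi : mass [:: 1%g] phi = F 1%g * phi 1%g.
Proof. by rewrite /mass /smooth /avg !big_seq1 !divr1 invg1 !mulg1. Qed.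

Lemma closed_hypograph : closed hypograph.
Proof.
have cc (i : option G) : continuous (fun u : X => u i).
  exact: coord_continuous.
have c0 (a : R) := @const_continuous R X a.
rewrite (_ : hypograph =
    [set u : X | forall x, u (Some x^-1%g) = u (Some x)] `&`
    [set u : X | forall r, 0 <= gram (u \o Some) r] `&`
    [set u : X | u (Some 1%g) = 1] `&` [set u : X | 0 <= u None] `&`
    [set u : X | forall s, s != [::] -> u None <= mass s (u \o Some)]);
  last first.
  by apply/seteqP; split=> u; [case=> -[] | case=> -[[[]]]].
do !apply: closedI.
- by apply: closed_forall => x; apply: closed_eq_continuous.
- apply: closed_forall => r; apply: closed_le_continuous => //.
  by apply: sum_continuous => p; apply: sum_continuous => q;
    apply: scaled_continuous; exact: cc.
- exact: closed_eq_continuous.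
- exact: closed_le_continuous.
- apply: closed_forall => s.
  have [->|s0] := eqVneq s [::].
    by rewrite (_ : [set u : X | _] = setT) //; apply/seteqP; split.
  rewrite (_ : [set u : X | _] = [set u : X | u None <= mass s (u \o Some)]).
    apply: closed_le_continuous => //; apply: avg_continuous => x.
    by apply: avg_continuous => y;
      apply: scaled_continuous; exact: cc.
  by apply/seteqP; split=> u /=; [exact | move=> ? _].
Qed.

Lemma compact_hypograph : compact hypograph.
Proof.
pose b := 1 + F 1%g.
apply: (@subclosed_compact _ _ [set u : X | forall i, u i \in `[- b, b]]).
- exact: closed_hypograph.
- pose B (_ : option G) : set R := [set` `[- b, b]].
  have cB i : compact (B i) by exact: segment_compact.
  have := @tychonoff (option G) (fun=> R) B cB.
  exact.
move=> u [pd u1 u0 um] [x|] /=; rewrite in_itv /= -ler_norml.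
  apply: le_trans (pos_def_norm_le x pd) _; by rewrite /= u1 /b lerDl ltW.
rewrite ger0_norm //; have /um := isT : [:: 1%g : G] != [::].
by rewrite mass_nil1 /= u1 mulr1 /b => /le_trans; apply; rewrite lerDr.
Qed.

Lemma massD s phi psi :
  mass s (fun x => phi x + psi x) = mass s phi + mass s psi.
Proof.
by rewrite /mass -smoothD; congr smooth; apply/funext => x; rewrite mulrDr.
Qed.

Lemma massZ s a phi : mass s (fun x => a * phi x) = a * mass s phi.
Proof.
by rewrite /mass -smoothZ; congr smooth; apply/funext => x; rewrite mulrCA.
Qed.

Definition extend (c : R) phi : X := fun i => if i is Some x then phi x else c.

(** An extremal [phi] is proportional to each [phi (g * z) + phi (g^-1 * z)],
    because the latter can be added to or subtracted from a multiple of [phi]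
    within positive definite functions. *)
Lemma exists_cosine : exists phi c,
  [/\ [/\ pos_def phi, phi 1%g = 1 &
        forall x y, phi (x * y)%g + phi (x * y^-1)%g = 2 * (phi x * phi y)],
      0 < c, (forall s, s != [::] -> c <= mass s phi) &
      forall e, 0 < e -> exists2 s, s != [::] & mass s phi < c + e].
Proof.
have pdF : pos_def F.
  have := F_mul (@pos_def_cst1 R G); congr pos_def.
  by apply/funext => x; rewrite mulr1.
have Ki : 0 < (F 1%g)^-1 by rewrite invr_gt0.
(* The normalisation of [F] shows that the maximum is positive. *)
have hF : hypograph (extend (m / F 1%g) (fun x => (F 1%g)^-1 * F x)).
  split=> /=.
  - exact: pos_defZ (ltW Ki) pdF.
  - by rewrite mulVf // gt_eqF.
  - by rewrite divr_ge0 // ltW.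
  - move=> s s0; rewrite massZ mulrC ler_pM2l //; exact: F_sqr.
have K0 : hypograph !=set0 by eexists; exact: hF.
have [u [[pd u1 u0 um] umax uext]] :=
  exists_extreme_max None closed_hypograph compact_hypograph K0.
set phi := u \o Some; set c := u None.
have c0 : 0 < c by apply: lt_le_trans (umax _ hF); rewrite /= divr_gt0.
exists phi, c; split=> //; last first.
  move=> e e0; apply: contrapT => ns.
  have /umax /= : hypograph (extend (c + e) phi); last by rewrite -/c; lra.
  split=> //=; first by lra.
  by move=> s s0; rewrite leNgt; apply/negP => lt; apply: ns; exists s.
(* The infimum of the mass is additive: a convolution is better than both of its
   factors.  So both halves of [phi] attain the maximum. *)
have half psi1 psi2 : pos_def psi1 -> pos_def psi2 -> psi2 1%g = 1 ->
    (forall x, psi1 x + psi2 x = 2 * phi x) ->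
    forall s, s != [::] -> c <= mass s psi1.
  move=> pd1 pd2 psi21 mid s s0; rewrite leNgt; apply/negP => lt.
  have : hypograph (extend (2 * c - mass s psi1) psi2).
    split=> //=; first by lra.
    move=> t t0; have := um _ (conv_neq0 s0 t0).
    have := smooth_conv_le mulgC s t0 (F_mul pd1).
    have := smooth_conv_le mulgC t s0 (F_mul pd2).
    rewrite smooth_convC // -!/(mass _ _) => le1 le2 le3.
    have := massD (conv s t) psi1 psi2; rewrite (funext mid) massZ => eq_mass.
    by move: le1 le2 le3 eq_mass; rewrite -/phi -/c; lra.
  by move=> /umax /=; rewrite -/c; lra.
have extr psi1 psi2 : pos_def psi1 -> pos_def psi2 -> psi1 1%g = 1 ->
    psi2 1%g = 1 -> (forall x, psi1 x + psi2 x = 2 * phi x) ->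
    forall x, psi1 x = phi x.
  move=> pd1 pd2 psi11 psi21 mid x.
  have mid' z : psi2 z + psi1 z = 2 * phi z by rewrite addrC.
  apply: (uext (extend c psi1) (extend c psi2) _ _ _ (Some x)).
  - by split=> //=; exact: (half psi1 psi2).
  - by split=> //=; exact: (half psi2 psi1).
  - by case=> [z|] /=; [exact: mid | rewrite -/c; lra].
split=> // x g; rewrite (mulgC x) (mulgC x).
have a1 : `|phi g| <= 1 by rewrite -u1; exact: (pos_def_norm_le g pd).
have [ge le] : -1 <= phi g /\ phi g <= 1.
  by move: a1; rewrite ler_norml => /andP[].
have phiV y : phi y^-1%g = phi y by case: pd => + _; exact.
pose psi e z := (1 - e * phi g) / 2 * phi z +
  4^-1 * sandwich phi [:: (1, 1%g); (e, g)] z.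
have pd_psi e : 0 <= (1 - e * phi g) / 2 -> pos_def (psi e).
  move=> e0; apply: pos_defD; first exact: pos_defZ.
  by apply: pos_defZ; [rewrite invr_ge0 | exact: pos_def_sandwich].
have psi1 e : e ^+ 2 = 1 -> psi e 1%g = 1.
  by move=> e2; rewrite /psi sandwich_pair e2 !mulg1 phiV [phi 1%g]u1; lra.
have avg_psi z : psi 1 z + psi (-1) z = 2 * phi z.
  by rewrite /psi !sandwich_pair; lra.
have p1 : pos_def (psi 1) by apply: pd_psi; lra.
have pN1 : pos_def (psi (-1)) by apply: pd_psi; lra.
have psi11 : psi 1 1%g = 1 by apply: psi1; rewrite expr1n.
have psiN11 : psi (-1) 1%g = 1 by apply: psi1; rewrite sqrrN expr1n.
have := extr (psi 1) (psi (-1)) p1 pN1 psi11 psiN11 avg_psi x.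
by rewrite /psi sandwich_pair (mulrC (phi x)); lra.
Qed.

End Extremal.

(** * Characters separate points *)

Section Separation.
Context (R : realType) (G : topologicalGroupType).
Hypotheses (mulgC : forall g h : G, (g * h)%g = (h * g)%g)
  (G_hausdorff : hausdorff_space G) (G_compact : compact [set: G]).

Lemma exists_separating_function (g : G) : g <> 1%g -> exists k : G -> R,
  [/\ continuous k, forall x, 0 <= k x <= 1, k 1%g = 0 & k g = 1].
Proof.
move=> g1; have acc := hausdorff_accessible G_hausdorff.
have cl1 := accessible_closed_set1 acc.
have sep : uniform_separator [set 1%g] [set g].
  have nG := compact_normal G_hausdorff G_compact.
  apply: ((@normal_separatorP R G).1 nG) => //.
  by apply/seteqP; split=> // x [-> /esym].
have [k [ck k01 k0 k1]] := (uniform_separatorP (R := R) _ _).1 sep.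
exists k; split=> //.
- by move=> x; have := k01 (k x); rewrite /= in_itv /=; apply; exists x.
- by apply: k0; exists 1%g.
- by apply: k1; exists g.
Qed.

(** For [g] near [1], uniform continuity of [F] and the cosine equation make the
    sum of the two translates of [F * phi] by [g] and its inverse close to
    [2 * phi g * (F * phi)].  Hence averaging over [1] and [g] multiplies the
    mass by about [(1 + phi g) / 2]; as the mass starts near its positive infimum
    and stays above it, [phi g] is close to [1]. *)
Lemma cosine_near1 (F phi : G -> R) (c : R) :
  unif_cont F -> phi 1%g = 1 -> (forall x, `|phi x| <= 1) ->
  (forall x y, phi (x * y)%g + phi (x * y^-1)%g = 2 * (phi x * phi y)) ->
  0 < c -> (forall s, s != [::] -> c <= mass F s phi) ->
  (forall e, 0 < e -> exists2 s, s != [::] & mass F s phi < c + e) ->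
  forall e, 0 < e -> \forall g \near (1%g : G), 1 - phi g <= e.
Proof.
move=> uF phi1 phi_le1 phi_cos c0 cle clt e e0.
apply: filterS (uF _ (mulr_gt0 c0 e0)) => g Fg.
have [phige phile] : -1 <= phi g /\ phi g <= 1.
  by have := phi_le1 g; rewrite ler_norml => /andP[].
rewrite -(ler_pM2l c0); apply/ler_addgt0Pr => e' e'0.
have [s s0 lt] := clt (e' / 2) (divr_gt0 e'0 (ltr0n _ 2)).
have := cle _ (conv_neq0 s0 (isT : [:: 1%g; g] != [::])).
rewrite /mass (smooth_conv_pair mulgC) -!/(mass F s phi).
set psi := fun x => F x * phi x.
have near z : psi (g * z)%g + psi (g^-1 * z)%g <=
    2 * phi g * psi z + 2 * (c * e).
  have : `|F (g * z)%g - F z| <= c * e by exact: Fg.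
  have : `|F (g^-1 * z)%g - F z| <= c * e.
    by rewrite distrC; have := Fg (g^-1 * z)%g; rewrite mulVKg.
  have := phi_le1 (g * z)%g; have := phi_le1 (g^-1 * z)%g.
  have := phi_cos z g; rewrite (mulgC z) (mulgC z) /psi.
  rewrite !ler_norml => eq_cos /andP[? ?] /andP[? ?] /andP[? ?] /andP[? ?].
  have -> : 2 * phi g * (F z * phi z) =
      F z * (phi (g * z)%g + phi (g^-1 * z)%g) by rewrite eq_cos; ring.
  nra.
have : smooth s psi g + smooth s psi g^-1%g <=
    2 * phi g * mass F s phi + 2 * (c * e).
  rewrite -{1}[g]mulg1 -{1}[g^-1%g]mulg1 -!smooth_shift // -smoothD.
  apply: le_trans (le_smooth _ _ near) _.
  rewrite smoothD smoothZ /smooth.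
  rewrite [X in _ + X <= _](_ : _ = 2 * (c * e)) //.
  by rewrite (eq_avg _ (fun=> avg_cst _ s0)) avg_cst.
have : (1 + phi g) * mass F s phi <= (1 + phi g) * (c + e' / 2).
  by apply: ler_wpM2l; [lra | exact: ltW].
have : phi g * e' <= e' by rewrite ler_piMl // ltW.
lra.
Qed.

(** If [phi] were [g]-periodic, then the second difference of [h] times [phi]
    would be the second difference of [h * phi].  Its mass at [s] is four times
    what averaging over [1] and [g] takes off [smooth s (h * phi) 1], and next to
    nothing can be taken off near the infimum. *)
Lemma cosine_neq1 (h phi : G -> R) (g : G) (c : R) :
  pos_def (fun x => h x * phi x) -> 0 < c ->
  (forall s, s != [::] ->
    c <= mass (fun x => 2 * h x - (h (g * x)%g + h (g^-1 * x)%g)) s phi) ->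
  ~ (forall x, phi (g * x)%g = phi x).
Proof.
move=> pd c0 cle per; set psi := fun x => h x * phi x in pd.
have perV x : phi (g^-1 * x)%g = phi x by rewrite -per mulVKg.
pose E : set R := [set a | exists2 s, s != [::] & a = smooth s psi 1%g].
have Einf : has_inf E.
  split; first by exists (smooth [:: 1%g] psi 1%g), [:: 1%g].
  by exists 0 => _ [s _ ->]; exact: smooth_ge0.
have c8 : 0 < c / 8 by lra.
have [_ [s s0 ->] lt] := inf_adherent c8 Einf.
have ge : inf E <= smooth (conv s [:: 1%g; g]) psi 1%g.
  apply: ge_inf; first by case: Einf.
  by exists (conv s [:: 1%g; g]) => //; exact: conv_neq0.
have := cle s s0; rewrite /mass.
rewrite (_ : (fun x => _) = fun x =>
    2 * psi x + (-1) * (psi (g * x)%g + psi (g^-1 * x)%g)); last first.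
  by apply/funext => x; rewrite /psi per perV; ring.
rewrite smoothD !smoothZ smoothD !smooth_shift // !mulg1.
by move: ge lt; rewrite smooth_conv_pair //; lra.
Qed.

End Separation.

Section Characters.
Context (R : realType) (G : topologicalGroupType).
Hypotheses (mulgC : forall g h : G, (g * h)%g = (h * g)%g)
  (G_hausdorff : hausdorff_space G) (G_compact : compact [set: G]).

(** Averaging further over a finite family that meets every translate of a
    neighbourhood on which [psi] is large only decreases [smooth s psi 1], and
    makes it visibly bounded below. *)
Lemma smooth_lower_bound (psi : G -> R) : pos_def psi -> unif_cont psi ->
  (forall x, 0 <= psi x) -> 0 < psi 1%g ->
  exists2 m, 0 < m & forall s, s != [::] -> m <= smooth s psi 1%g.
Proof.
move=> pd uc psi0 psi1; have e0 : 0 < psi 1%g / 2 by lra.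
have [t tP] := translates_cover G_compact (uc _ e0).
have t0 : t != [::] by have [y] := tP 1%g; case: t {tP}.
have N0 : 0 < (size t)%:R :> R by rewrite ltr0n lt0n size_eq0.
exists (psi 1%g / 2 / (size t)%:R) => [|s s0]; first exact: divr_gt0.
apply: le_trans (smooth_conv_le mulgC s t0 pd); rewrite smooth_conv // avgC.
apply: avg_ge => // y; rewrite /smooth avgC; apply: avg_ge => // a'.
rewrite avgC; apply: avg_ge => // b.
have [x xt /(_ 1%g)] := tP (a' * b^-1 * y^-1)%g.
rewrite mulg1 ler_distl => /andP[le _].
rewrite -[leLHS]add0r; apply: (avg_ge_one xt) => // .
rewrite add0r (mulgC x) mulgA; lra.
Qed.

Local Open Scope complex_scope.

(** Continuity at [1] of the real part suffices, since the squared distance from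
    [chi g] to [1] is [2 - 2 * phi g]. *)
Lemma character_of_cosine (phi sigma : G -> R) : phi 1%g = 1 ->
  (forall x y, phi (x * y)%g = phi x * phi y - sigma x * sigma y) ->
  (forall x y, sigma (x * y)%g = sigma x * phi y + phi x * sigma y) ->
  (forall x, phi x ^+ 2 + sigma x ^+ 2 = 1) ->
  (forall e, 0 < e -> \forall g \near (1%g : G), 1 - phi g <= e) ->
  character_group (fun x => phi x +i* sigma x : R[i]^o).
Proof.
move=> phi1 phiM sigmaM sq near1; set chi : G -> R[i]^o := fun x => _.
have chiM g h : chi (g * h)%g = (chi g : R[i]) * (chi h : R[i]).
  rewrite /chi phiM sigmaM; apply/eqP; rewrite eq_complex /= eqxx /=.
  by rewrite addrC.
have chi_norm g : `|chi g : R[i]| = 1 by rewrite normc_def /= sq sqrtr1.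
have chi_dist g : `|(chi g : R[i]) - 1| = (Num.sqrt (2 * (1 - phi g)))%:C.
  rewrite normc_def /=; congr (Num.sqrt _)%:C.
  by have := sq g; rewrite !expr2 => ?; lra.
split=> // x; apply/cvgrPdist_lt => /= e.
rewrite ltcE /= => /andP[/eqP e_im e0].
have e2 : 0 < (complex.Re e) ^+ 2 / 4 by rewrite divr_gt0 // exprn_gt0.
have : \forall y \near x, 1 - phi (y * x^-1)%g <= (complex.Re e) ^+ 2 / 4.
  have := @mulgl_continuous G x^-1%g x; rewrite /continuous_at mulgV => cx.
  exact: cx _ (near1 _ e2).
apply: filterS => y ye.
rewrite distrC (_ : chi y - chi x =
    (((chi (y * x^-1)%g : R[i]) - 1) * (chi x : R[i]) : R[i])); last first.
  by rewrite mulrBl -chiM mulgVK mul1r.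
rewrite [`|_|](normrM (_ : R[i])) chi_norm mulr1 chi_dist ltcE /= e_im eqxx /=.
rewrite -[ltRHS]ger0_norm ?(ltW e0) // -sqrtr_sqr ltr_sqrt ?exprn_gt0 //.
have := exprn_gt0 2 e0; lra.
Qed.

(** The function [k] separates [g] from [1], so the difference of [k] and its
    translate by [g] has an autocorrelation [F] with [F 1] positive. *)
Theorem characters_separate_points (g : G) : g <> 1%g ->
  exists2 chi : G -> R[i]^o, character_group chi & chi g != 1.
Proof.
move=> /(exists_separating_function R G_hausdorff G_compact)[k [ck k01 k1 kg]].
have k_le1 x : `|k x| <= 1 by have := k01 x; rewrite ler_norml => ?; lra.
have uk := continuous_unif_cont G_compact ck.
have [h kh] := autocorr_exists mulgC G_compact k_le1 uk.
pose kd x := k (g * x)%g - k x.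
pose F x := 2 * h x - (h (g * x)%g + h (g^-1 * x)%g).
have kF : autocorr kd F by exact: autocorr_diff.
have kd_le1 x : `|kd x| <= 1.
  by have := k01 x; have := k01 (g * x)%g; rewrite /kd ler_norml => ? ?; lra.
have ukd : unif_cont kd by apply: unif_contB => //; exact: unif_cont_shift.
have uF : unif_cont F by exact: autocorr_unif_cont kF kd_le1 ukd.
have F1 : 0 < F 1%g.
  apply: (autocorr_gt0 mulgC G_compact kF) => //.
  by rewrite /kd mulg1 kg k1 subr0 oner_eq0.
have F_mul phi : pos_def phi -> pos_def (fun x => F x * phi x).
  exact: pos_def_autocorrM kF phi.
have pdF : pos_def F by exact: pos_def_autocorr kF.
have F_le x : `|F x| <= F 1%g by exact: pos_def_norm_le.
have F_sqr1 : 0 < F 1%g * F 1%g by rewrite mulr_gt0.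
have [||m m0 mP] := smooth_lower_bound (F_mul _ pdF) _ _ F_sqr1.
- exact: (unif_contM F1 F_le F_le uF uF).
- by move=> x; rewrite -expr2 sqr_ge0.
have [phi [c [[pd phi1 phi_cos] c0 cle clt]]] :=
  exists_cosine mulgC F_mul F1 m0 mP.
have phi_le1 x : `|phi x| <= 1 by rewrite -phi1; exact: pos_def_norm_le.
have phiV x : phi x^-1%g = phi x by case: pd.
have [sigma [phiM sigmaM sq]] := cosine_sine mulgC phi1 phiV phi_le1 phi_cos.
have near1 := cosine_near1 mulgC uF phi1 phi_le1 phi_cos c0 cle clt.
exists (fun x => phi x +i* sigma x); first exact: character_of_cosine.
rewrite eq_complex /=; apply/negP => /andP[/eqP phig /eqP sg].
apply: (cosine_neq1 mulgC (pos_def_autocorrM mulgC kh pd) c0 cle) => x.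
by rewrite phiM phig sg mul1r mul0r subr0.
Qed.

End Characters.

(** * Freeness *)

Section CharacterRepresentation.
Context (R : realType) (G : topologicalGroupType) (V : tvsType R[i]).
Variable chi : G -> R[i]^o.
Hypothesis chi_char : character_group chi.

Let chi_cont : continuous chi. Proof. by case: chi_char. Qed.
Let chiM g h : chi (g * h)%g = (chi g : R[i]) * (chi h : R[i]).
Proof. by case: chi_char. Qed.

Lemma character_neq0 g : (chi g : R[i]) != 0.
Proof. by case: chi_char => _ n _; rewrite -normr_eq0 n oner_eq0. Qed.

Lemma character1 : chi 1%g = 1.
Proof.
apply: (mulfI (character_neq0 1%g)); rewrite mulr1.
by rewrite -[LHS]chiM mulg1.
Qed.

Definition char_scale (g : G) : {linear V -> V} := GRing.scale (chi g : R[i]).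

Lemma char_scale1 v : char_scale 1%g v = v.
Proof. by rewrite /char_scale /= character1 scale1r. Qed.

Lemma char_scaleM g h v :
  char_scale (g * h)%g v = char_scale g (char_scale h v).
Proof. by rewrite /char_scale /= chiM -scalerA. Qed.

Lemma char_scale_continuous : continuous (fun x : G * V => char_scale x.1 x.2).
Proof.
move=> [g v]; have cchi : chi p.1 @[p --> (g, v)] --> chi g.
  apply: (@continuous_comp (G * V)%type _ _ fst chi (g, v)).
    exact: cvg_fst.
  exact: chi_cont.
have cpair : (chi p.1, p.2) @[p --> (g, v)] --> (chi g, v).
  exact: (cvg_pair cchi cvg_snd).
apply: (@continuous_comp _ _ _ (fun p : G * V => (chi p.1, p.2))
  (fun z : R[i]^o * V => z.1 *: z.2)); last exact: scale_continuous.
exact: cpair.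
Qed.

Definition char_rep : representation G V :=
  Build_representation char_scale1 char_scaleM char_scale_continuous.

Lemma character_inv : (forall g h : G, (g * h)%g = (h * g)%g) ->
  character_group (fun g => chi g^-1%g).
Proof.
move=> mulgC; case: chi_char => cc n m; split; [move=> g|move=> g|move=> g h].
- apply: (@continuous_comp _ _ _ (fun g => g^-1)%g chi).
    exact: invg_continuous.
  exact: cc.
- exact: n.
- by rewrite invgM mulgC m.
Qed.

End CharacterRepresentation.

Section Spectrum.
Context (R : realType) (A : comLcAlgType R[i]).

Lemma spectrum_invertible_neq0 (eta : {linear A -> R[i]^o}) (a : A) :
  spectrum eta -> invertible a -> (eta a : R[i]) != 0.
Proof.
move=> [etaM [c c0]] [b [ab _]]; apply: contra_neq c0 => a0.
by rewrite -[c]mulr1 -ab !etaM a0 mul0r mulr0.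
Qed.

End Spectrum.

Theorem proposition5p6 (R : realType) (A : comLcAlgType R[i])
    (G : topologicalGroupType) (alpha : dynamical_system A G)
    (G_hausdorff : hausdorff_space G) (G_compact : compact [set: G])
    (G_abelian : forall g h : G, (g * h)%g = (h * g)%g)
    (A_invertible : forall phi : G -> R[i]^o, character_group phi ->
      exists2 a : A, isotypic alpha phi a & invertible a) :
  free_system alpha.
Proof.
exists {chi : G -> R[i]^o | character_group chi}, (fun=> R[i]^o),
  (fun chi => char_rep R[i]^o (svalP chi)); split.
- by move=> _; exact: norm_hausdorff.
- move=> g.
  move=> /(characters_separate_points R G_abelian G_hausdorff G_compact).
  move=> [chi cc cg].
  exists (exist _ chi cc), 1 => fix1; move/eqP: cg; apply.
  by rewrite -[LHS]mulr1; exact: fix1.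
move=> [chi cc] eta eta_spec v _ /=.
(* The inverse character makes the tensor of [a] with any vector invariant. *)
have [a iso_a inv_a] := A_invertible _ (character_inv cc G_abelian).
have {}iso_a g : alpha g a = (chi g^-1%g : R[i]) *: a := iso_a g.
have a0 := spectrum_invertible_neq0 eta_spec inv_a.
exists (tens a ((eta a : R[i])^-1 *: v)).
  move=> g.
  (* The two module structures of [A] at play are only convertible, hence the
     explicit congruence. *)
  rewrite tens_mapE [LHS](congr1 (fun x => tens x _) (iso_a g)).
  rewrite tensZl tensZr scalerA.
  have [_ _ chiM] := cc; rewrite -chiM mulVg (character1 cc).
  by rewrite scale1r.
by rewrite tens_evalE scalerA mulfV // scale1r.
Qed.
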